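(* Let $d\geq 1$. If a set $\mathscr{A}\subseteq (0,1)^{d}$ can be covered by an $F_{\sigma}$, purely unrectifiable set, then a typical $f\in\operatorname{Lip}_{1}([0,1]^{d})$ has no directional derivatives at any point of $\mathscr{A}$; moreover, for a typical $f\in\operatorname{Lip}_{1}([0,1]^{d})$ it holds that $\mathcal{D}f(x,v)=[-1,1]$ for every $x\in\mathscr{A}$ and every $v\in\mathbb{S}^{d-1}$.
   Context: $\operatorname{Lip}_{1}([0,1]^{d})$ denotes the set of all functions $f\colon[0,1]^d\to\mathbb{R}$ with Lipschitz constant at most $1$, viewed as a complete metric space with the supremum metric; ''typical'' means: the set of functions with the property is residual (complement meagre). A Lipschitz curve is a Lipschitz map $\gamma\colon I\to\mathbb{R}^d$, $I$ a closed interval, whose derivative is bounded away from zero in norm almost everywhere; $P\subseteq\mathbb{R}^d$ is purely unrectifiable if $\gamma^{-1}(P)$ is Lebesgue null for every Lipschitz curve $\gamma\colon[0,1]\to\mathbb{R}^d$. For $f\colon[0,1]^d\to\mathbb{R}$, $x\in(0,1)^d$ and $v\in\mathbb{S}^{d-1}$, the derived set $\mathcal{D}f(x,v)$ is the set of all existing limits $\lim_{n\to\infty}(f(x+t_nv)-f(x))/t_n$ over sequences $t_n\searrow 0$. *)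

(* Defs.v *)
From HB Require Import structures.
From mathcomp Require Import all_boot all_order all_algebra.
From mathcomp Require Import all_classical all_reals all_analysis.
Set Implicit Arguments. Unset Strict Implicit. Unset Printing Implicit Defensive.
Import Order.TTheory GRing.Theory Num.Theory.
Import numFieldNormedType.Exports.
Local Open Scope classical_set_scope.
Local Open Scope ring_scope.

Section Defs.
Variables (R : realType) (d : nat).

Definition pt := 'rV[R]_d.

Definition enorm (x : pt) : R := Num.sqrt (\sum_(i < d) (x 0 i) ^+ 2).

Definition cube : set pt := [set x | forall i : 'I_d, 0 <= x 0 i <= 1].
Definition open_cube : set pt := [set x | forall i : 'I_d, 0 < x 0 i < 1].

(* Lip_1([0,1]^d): functions whose restriction to [0,1]^d is 1-Lipschitz
   (for the Euclidean norm); values outside the cube are irrelevant. *)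
Definition Lip1 : set (pt -> R) :=
  [set f | forall x y, cube x -> cube y -> `|f x - f y| <= enorm (x - y)].

Definition supdist_lt (f g : pt -> R) (r : R) : Prop :=
  exists2 r' : R, r' < r & forall x, cube x -> `|f x - g x| <= r'.

Definition Lball (f : pt -> R) (r : R) : set (pt -> R) :=
  [set g | Lip1 g /\ supdist_lt f g r].

Definition nowhere_dense_Lip (N : set (pt -> R)) : Prop :=
  forall f r, Lip1 f -> 0 < r ->
    exists g s, [/\ Lip1 g, 0 < s, Lball g s `<=` Lball f r &
                    Lball g s `&` N = set0].

Definition meagre_Lip (S : set (pt -> R)) : Prop :=
  exists N : nat -> set (pt -> R),
    (forall n, nowhere_dense_Lip (N n)) /\ S `<=` \bigcup_n N n.

Definition typical (P : (pt -> R) -> Prop) : Prop :=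
  meagre_Lip [set f | Lip1 f /\ ~ P f].

Definition lipschitz_curve (gamma : R -> pt) : Prop :=
  (exists L : R, forall s t, `[0, 1]%classic s -> `[0, 1]%classic t ->
       enorm (gamma s - gamma t) <= L * `|s - t|) /\
  (exists2 c : R, 0 < c &
     (@lebesgue_measure R).-negligible
       [set t | `[0, 1]%classic t /\
                ~ (derivable gamma t 1 /\ c <= enorm ('D_1 gamma t))]).

Definition purely_unrectifiable (P : set pt) : Prop :=
  forall gamma : R -> pt, lipschitz_curve gamma ->
    (@lebesgue_measure R).-negligible (`[0, 1]%classic `&` gamma @^-1` P).

Definition Fsigma (P : set pt) : Prop :=
  exists F : nat -> set pt, (forall n, closed (F n)) /\ P = \bigcup_n F n.

Definition sphere : set pt := [set v | enorm v = 1].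

Definition has_dir_deriv (f : pt -> R) (x v : pt) : Prop :=
  exists l : R, (fun t : R => (f (x + t *: v) - f x) / t) @ 0^'+ --> l.

Definition derived_set (f : pt -> R) (x v : pt) : set R :=
  [set l | exists t : nat -> R,
     [/\ (forall n, 0 < t n), (forall n, t n.+1 < t n), t @ \oo --> 0 &
         (fun n => (f (x + t n *: v) - f x) / t n) @ \oo --> l]].

End Defs.

(* Main.v *)
Require Import Defs.
From HB Require Import structures.
From mathcomp Require Import all_boot all_order all_algebra.
From mathcomp Require Import all_classical all_reals all_analysis.
From mathcomp Require Import ring lra zify.
Import Order.TTheory GRing.Theory Num.Theory.
Import numFieldNormedType.Exports.
Set Implicit Arguments. Unset Strict Implicit. Unset Printing Implicit Defensive.
Local Open Scope classical_set_scope.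
Local Open Scope ring_scope.

(* Let [E] be a closed purely unrectifiable set, [e] a unit vector and [f] in [Lip1].
   For small [t] let [g] be the least 1-Lipschitz function above [f] such that
   [g (p + t e) >= g p + (1 - eta) t] for all [p] in [E]; it is a supremum over chains
   of points that either jump from some [p] in [E] to [p + t e] or move freely at the
   cost of the distance travelled.  If [g] exceeded [f + eps] for arbitrarily small
   [t], nearly optimal chains would be quasi-geodesics, with constants independent of
   [t], spending a fixed proportion of their length on jumps.  A limit of them is a
   bi-Lipschitz curve that meets [E] in positive measure, which is impossible.  So [f]
   is uniformly approximated by functions that are steep in direction [e] at every
   point of [E], and steepness at a given scale survives small perturbations.  Countably
   many sets [E], rational directions and both signs give, for a typical [f], difference
   quotients accumulating at [1] and [-1] in every direction, and the intermediate value
   theorem fills in [[-1, 1]]. *)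

(** * The Euclidean norm *)

Section Euclidean.
Variables (R : realType) (d : nat).
Implicit Types x y z : pt R d.

Definition dot x y : R := \sum_(i < d) x 0 i * y 0 i.

Lemma dotDr x y z : dot x (y + z) = dot x y + dot x z.
Proof. by rewrite -big_split; apply: eq_bigr => i _; rewrite mxE mulrDr. Qed.

Lemma dotZr x (a : R) y : dot x (a *: y) = a * dot x y.
Proof. by rewrite mulr_sumr; apply: eq_bigr => i _; rewrite mxE mulrCA. Qed.

Lemma dotr0 x : dot x 0 = 0.
Proof. by rewrite /dot big1 // => i _; rewrite mxE mulr0. Qed.

Lemma dotC x y : dot x y = dot y x.
Proof. by apply: eq_bigr => i _; rewrite mulrC. Qed.

Lemma dotNr x y : dot x (- y) = - dot x y.
Proof. by rewrite -scaleN1r dotZr mulN1r. Qed.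

Lemma dotDl x y z : dot (x + y) z = dot x z + dot y z.
Proof. by rewrite dotC dotDr !(dotC z). Qed.

Lemma dotZl (a : R) x y : dot (a *: x) y = a * dot x y.
Proof. by rewrite dotC dotZr dotC. Qed.

Lemma dotNl x y : dot (- x) y = - dot x y.
Proof. by rewrite dotC dotNr dotC. Qed.

Lemma dotxx_ge0 x : 0 <= dot x x.
Proof. by apply: sumr_ge0 => i _; rewrite -expr2 sqr_ge0. Qed.

Lemma enorm_ge0 x : 0 <= enorm x. Proof. exact: sqrtr_ge0. Qed.

Lemma enorm_sqr x : enorm x ^+ 2 = dot x x.
Proof.
rewrite /enorm sqr_sqrtr; first by apply: eq_bigr => i _; rewrite expr2.
by apply: sumr_ge0 => i _; rewrite sqr_ge0.
Qed.

Lemma coord_le_enorm x i : `|x 0 i| <= enorm x.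
Proof.
rewrite -sqrtr_sqr /enorm ler_wsqrtr // (bigD1 i) //= lerDl.
by apply: sumr_ge0 => j _; rewrite sqr_ge0.
Qed.

Lemma enorm0_eq0 x : enorm x = 0 -> x = 0.
Proof.
move=> x0; apply/rowP => i; rewrite mxE; apply/eqP.
by rewrite -normr_le0 -x0 coord_le_enorm.
Qed.

Lemma enorm0 : enorm (0 : pt R d) = 0.
Proof. by rewrite /enorm big1 ?sqrtr0 // => i _; rewrite mxE expr0n. Qed.

Lemma enormZ (a : R) x : enorm (a *: x) = `|a| * enorm x.
Proof.
apply/eqP; rewrite -(@eqrXn2 _ 2) ?mulr_ge0 ?enorm_ge0 //.
by rewrite exprMn !enorm_sqr dotZr dotZl mulrA -expr2 real_normK ?num_real.
Qed.

Lemma enormN x : enorm (- x) = enorm x.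
Proof. by rewrite -scaleN1r enormZ normrN1 mul1r. Qed.

Lemma enorm_distC x y : enorm (x - y) = enorm (y - x).
Proof. by rewrite -enormN opprB. Qed.

Lemma dot_le_enorm x y : dot x y <= enorm x * enorm y.
Proof.
set a := enorm x; set b := enorm y.
have a0 : 0 <= a := enorm_ge0 x.
have b0 : 0 <= b := enorm_ge0 y.
have [ab0|ab_neq0] := eqVneq (a * b) 0.
  rewrite ab0; move/eqP: ab0; rewrite mulf_eq0 => /orP[] /eqP /enorm0_eq0 ->.
    by rewrite dotC dotr0.
  by rewrite dotr0.
have ab_gt0 : 0 < a * b by rewrite lt_neqAle eq_sym ab_neq0 mulr_ge0.
(* Expanding this square gives [2 * (a * b) * (a * b - dot x y)]. *)
have := dotxx_ge0 (b *: x - a *: y).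
rewrite dotDr !dotDl !dotNr !dotNl !dotZr !dotZl [dot y x]dotC.
rewrite -!enorm_sqr -/a -/b => h.
have : 0 <= (a * b) * (a * b - dot x y) by nra.
by rewrite pmulr_rge0 // subr_ge0.
Qed.

Lemma enormD x y : enorm (x + y) <= enorm x + enorm y.
Proof.
rewrite -(@ler_pXn2r _ 2) ?nnegrE ?addr_ge0 ?enorm_ge0 //.
rewrite enorm_sqr dotDr !dotDl -!enorm_sqr [dot y x]dotC sqrrD.
by have := dot_le_enorm x y; lra.
Qed.

Lemma enorm_triangle z x y : enorm (x - y) <= enorm (x - z) + enorm (z - y).
Proof. by rewrite -[x - y](subrKA z) enormD. Qed.

Lemma norm_le_enorm x : `|x| <= enorm x.
Proof.
rewrite [`|x|]/Num.norm /= mx_normrE; apply/bigmax_leP; split; first exact: enorm_ge0.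
by case=> i j _ /=; rewrite ord1 coord_le_enorm.
Qed.

Lemma coord_le_norm x i : `|x 0 i| <= `|x|.
Proof.
by rewrite [leRHS]/Num.norm /= mx_normrE; apply: (le_bigmax _ _ (0, i)).
Qed.

Lemma enorm_le_coord x (a : R) : (forall i, `|x 0 i| <= a) -> enorm x <= d%:R * a.
Proof.
move=> xa; have [/eqP d0|d0] := boolP (d == 0%N).
  suff -> : x = 0 by rewrite enorm0 d0 mul0r.
  by apply/rowP => i; have := ltn_ord i; rewrite {2}d0.
have dpos : (0 < d)%N by rewrite lt0n.
have a0 : 0 <= a := le_trans (normr_ge0 _) (xa (Ordinal dpos)).
rewrite -(@ler_pXn2r _ 2) ?nnegrE ?mulr_ge0 ?enorm_ge0 // enorm_sqr.
have : dot x x <= \sum_(i < d) a ^+ 2.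
  apply: ler_sum => i _; rewrite -expr2 -real_normK ?num_real //.
  by rewrite lerXn2r ?nnegrE.
move=> /le_trans; apply; rewrite sumr_const card_ord -[leLHS]mulr_natl exprMn.
by rewrite ler_wpM2r ?sqr_ge0 // -natrX ler_nat leq_pmulr.
Qed.

Lemma enorm_le_norm x : enorm x <= d%:R * `|x|.
Proof. by apply: enorm_le_coord => i; exact: coord_le_norm. Qed.

End Euclidean.

(** * Almost everywhere differentiability of Lipschitz curves *)

Section LipschitzCdf.
Variables (R : realType) (k : R -> R) (C : R).
Hypothesis k_nd : {homo k : x y / x <= y}.
Hypothesis k_lip : forall x y, `|k x - k y| <= C * `|x - y|.
Hypothesis k_le0 : forall x : R, x <= 0 -> k x = 0.
Hypothesis k_ge1 : forall x, 1 <= x -> k x = 1.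

Let C0 : 0 <= C.
Proof.
have := k_lip 1 0; rewrite subr0 normr1 mulr1; exact: le_trans.
Qed.

Let k_cont : continuous k.
Proof.
move=> x; apply/cvgrPdist_le => /= e e0; near=> y.
apply: le_trans (k_lip x y) _.
have : `|x - y| <= e / (C + 1).
  near: y; apply: cvgr_dist_le; first exact: cvg_id.
  by rewrite divr_gt0 // ltr_pwDr.
rewrite ler_pdivlMr ?ltr_pwDr // mulrDr mulr1 mulrC => h.
by apply: le_trans h; rewrite lerDl.
Unshelve. all: by end_near. Qed.

Let k_rc : right_continuous k.
Proof. exact: right_continuousW. Qed.

HB.instance Definition _ := isCumulative.Build R _ R k k_nd k_rc.

Let k_Ny : k @ -oo --> (0 : R).
Proof.
apply: cvg_near_cst; exists 0; split => // x /ltW x0.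
by rewrite k_le0.
Qed.

Let k_y : k @ +oo --> (1 : R).
Proof.
apply: cvg_near_cst; exists 1; split => // x /ltW x0.
by rewrite k_ge1.
Qed.

HB.instance Definition _ := isCumulativeBounded.Build R 0 1 k k_Ny k_y.

Let nu : probability _ R := lebesgue_stieltjes_measure k.
Let mu := @lebesgue_measure R.

(** A null set has covers by half-open intervals of arbitrarily small total length, and the
    increments of [k] over them are at most [C + 1] times as large. The [+ 1] keeps the divisor
    positive. *)
Let nu_dom : nu `<< mu.
Proof.
apply/null_content_dominatesP => A mA muA0.
have A0 : mu A = 0%E := muA0.
apply/eqP; rewrite eq_le measure_ge0 andbT.
apply/lee_addgt0Pr => e e0; rewrite add0e.
have : (mu A < (e / (C + 1))%:E)%E.
  by rewrite A0 lte_fin divr_gt0 // ltr_pwDr.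
move=> /ereal_inf_lt[_ [/= B [mB AB] <-] Be].
apply: (@le_trans _ _ (\sum_(i <oo) wlength k (B i))%E).
  by apply: ereal_inf_lbound; exists B.
have le1 i : (wlength k (B i) <= (C + 1)%:E * wlength idfun (B i))%E.
  have [[a b] _ <-] := mB i.
  case: (leP a b) => ab /=; last first.
    by rewrite set_itv_ge ?wlength0 ?mule0 // bnd_simp -leNgt ltW.
  rewrite !wlength_itv_bnd //= -EFinM lee_fin.
  apply: le_trans (ler_norm _) (le_trans (k_lip _ _) _).
  rewrite ger0_norm ?subr_ge0 // ler_wpM2r ?subr_ge0 // lerDl //.
have C1 : 0 < C + 1 by rewrite ltr_pwDr.
apply: (@le_trans _ _ ((C + 1)%:E * \sum_(i <oo) wlength idfun (B i))%E).
  rewrite -nneseriesZl; last by move=> i _; exact: wlength_ge0.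
  by apply: lee_nneseries => [i _ _|i _]; [exact: wlength_ge0 | exact: le1].
apply: le_trans (lee_wpmul2l _ (ltW Be)) _.
  by rewrite lee_fin ltW.
by rewrite -EFinM lee_fin mulrC divfK // gt_eqF.
Qed.

(* The Lebesgue-Stieltjes measure of [k] is dominated by a multiple of the Lebesgue
   measure, so [k] is the integral of its Radon-Nikodym density. *)
Lemma lipschitz_cdf_derivable : {ae mu, forall x, -1 < x -> derivable k x 1}.
Proof.
pose phi := Radon_Nikodym (charge_of_finite_measure nu) mu.
pose g (x : R) : R := fine (phi x).
have phiE x : phi x = (g x)%:E.
  by rewrite /g fineK //; exact: Radon_Nikodym_fin_num.
have intg : mu.-integrable setT (EFin \o g).
  have -> : EFin \o g = phi by apply/funext => x; rewrite phiE.
  exact: Radon_Nikodym_integrable.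
have intgA (A : set R) : measurable A -> mu.-integrable A (EFin \o g).
  by move=> mA; apply: integrableS intg.
have locg : locally_integrable [set: R] g.
  by rewrite -(patch_setT (fun=> 0) g); exact: (integrable_locally measurableT intg).
have := @FTC1 R g (BRight (-1)) (fun y => intgA _ (measurable_itv _)) locg.
apply: filterS; first exact: (ae_filter_ringOfSetsType mu).
move=> x h x1.
have [+ _] := h x1.
(* [FTC1] differentiates the primitive of [g] based at -1. As [k] vanishes at -1, the [nu]-mass of
   the interval from -1 to [y] is [k y], so this primitive is [k] near [x]. *)
apply: near_eq_derivable.
near=> y.
have y1 : -1 < y by near: y; exact: lt_nbhsr.
pose I : set R := `]-1, y]%classic.
have mI : measurable I by exact: measurable_itv.
have e1 := @Radon_Nikodym_integral _ _ _ (charge_of_finite_measure nu) mu I nu_dom mI.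
have e2 : nu I = (\int[mu]_(t in I) phi t)%E by exact: e1.
have e3 : (\int[mu]_(t in I) phi t)%E = (\int[mu]_(t in I) (g t)%:E)%E.
  by apply: eq_integral => t _; rewrite phiE.
have e4 : nu I = (k y)%:E.
  rewrite /nu /= /lebesgue_stieltjes_measure /measure_extension.
  rewrite measurable_mu_extE /=; last exact: is_ocitv.
  by rewrite wlength_itv_bnd ?ltW //= (k_le0 (x := -1)) ?subr0 // lerN10.
rewrite /Rintegral -e3 -e2 e4.
by [].
Unshelve. all: by end_near. Qed.
End LipschitzCdf.

Section LipschitzCurves.
Variable R : realType.

Definition clamp (x : R) : R := Num.max 0 (Num.min 1 x).

Lemma clamp_nd : {homo clamp : x y / x <= y}.
Proof.
move=> x y xy; rewrite /clamp /Num.max /Num.min.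
by repeat case: ifPn => //; rewrite -?leNgt; lra.
Qed.

Lemma clamp_dist x y : `|clamp x - clamp y| <= `|x - y|.
Proof.
wlog xy : x y / x <= y.
  move=> h; have [/h//|/ltW /h] := leP x y.
  by rewrite distrC [leRHS]distrC.
rewrite distrC [leRHS]distrC !ger0_norm ?subr_ge0 ?clamp_nd //.
move: xy; rewrite /clamp /Num.max /Num.min.
by repeat case: ifPn => //; rewrite -?leNgt; lra.
Qed.

Lemma clamp_itv x : 0 <= clamp x <= 1.
Proof.
rewrite /clamp /Num.max /Num.min.
by repeat case: ifPn => //; rewrite -?leNgt; lra.
Qed.

Lemma clamp_id x : 0 <= x <= 1 -> clamp x = x.
Proof.
case/andP=> x0 x1; rewrite /clamp min_r // max_r //.
Qed.

Lemma lipschitz_derivable_ae (f : R -> R) L :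
  (forall x y, `|f x - f y| <= L * `|x - y|) ->
  {ae @lebesgue_measure R, forall x, 0 < x < 1 -> derivable f x 1}.
Proof.
move=> f_lip.
have L0 : 0 <= L.
  by have := f_lip 1 0; rewrite subr0 normr1 mulr1; exact: le_trans.
(* [k] below is [f] plus a linear function, normalised to a distribution function. *)
pose D := f 1 - f 0 + (L + 1).
(* The slope [L + 1] instead of [L] makes the total increase at least 1, so that it can be divided
   out. *)
have D1 : 1 <= D.
  have := f_lip 1 0; rewrite subr0 normr1 mulr1 ler_norml /D; lra.
have D0 : 0 < D by lra.
pose g x := f x - f 0 + (L + 1) * x.
have g_nd : {homo g : x y / x <= y}.
  move=> x y xy; have := f_lip y x.
  rewrite (ger0_norm (x := y - x)) ?subr_ge0 // ler_norml => /andP[+ _].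
  rewrite /g; lra.
have g_lip x y : `|g x - g y| <= (2 * L + 1) * `|x - y|.
  have -> : g x - g y = (f x - f y) + (L + 1) * (x - y) by rewrite /g; ring.
  apply: le_trans (ler_normD _ _) _.
  have := f_lip x y; rewrite normrM (ger0_norm (x := L + 1)); lra.
pose k x := g (clamp x) / D.
have k_nd : {homo k : x y / x <= y}.
  by move=> x y xy; rewrite ler_wpM2r ?invr_ge0 ?(ltW D0) // g_nd // clamp_nd.
have k_lip x y : `|k x - k y| <= ((2 * L + 1) / D) * `|x - y|.
  rewrite -mulrBl normrM (gtr0_norm (x := D^-1)) ?invr_gt0 // mulrAC.
  rewrite ler_wpM2r ?invr_ge0 ?(ltW D0) //.
  apply: le_trans (g_lip _ _) _.
  by rewrite ler_wpM2l ?clamp_dist //; lra.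
have k_le0 x : x <= 0 -> k x = 0.
  move=> x0; rewrite /k /clamp max_l; last by rewrite ge_min x0 orbT.
  by rewrite /g subrr mulr0 addr0 mul0r.
have k_ge1 x : 1 <= x -> k x = 1.
  move=> x1; rewrite /k /clamp min_l // max_r //.
  by rewrite /g mulr1 divff // gt_eqF.
have := lipschitz_cdf_derivable k_nd k_lip k_le0 k_ge1.
apply: filterS; first exact: (ae_filter_ringOfSetsType (@lebesgue_measure R)).
move=> x h /andP[x0 x1].
have {}h : derivable k x 1 by apply: h; lra.
(* Inside the unit interval the clamp is inactive, and this expression is [f]. *)
have : derivable (fun y => D *: k y + (cst (f 0) y - (L + 1) *: y)) x 1.
  apply: derivableD; first exact: derivableZ.
  by apply: derivableB; [exact: derivable_cst | apply: derivableZ; exact: derivable_id].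
apply: near_eq_derivable; near=> y.
rewrite /k clamp_id; last first.
  by apply/andP; split; near: y;
    [apply: filterS (lt_nbhsr x0) => ? /ltW | apply: filterS (lt_nbhsl x1) => ? /ltW].
rewrite /g /GRing.scale /= mulrC divfK ?gt_eqF //; ring.
Unshelve. all: by end_near. Qed.

Variable d : nat.

(** The coordinates are differentiable almost everywhere, and the lower bound on difference
    quotients passes to their limit. The endpoints, where the lower bound is only one-sided, are
    discarded as a null set. *)
Lemma bilipschitz_curve (gamma : R -> pt R d) (L c : R) : 0 < c ->
  (forall s t, enorm (gamma s - gamma t) <= L * `|s - t|) ->
  (forall s t, 0 <= s <= 1 -> 0 <= t <= 1 ->
     c * `|s - t| <= enorm (gamma s - gamma t)) ->
  lipschitz_curve gamma.
Proof.
move=> c0 g_lip g_low; split; first by exists L => s t _ _; exact: g_lip.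
exists c => //.
have ae i : {ae @lebesgue_measure R, forall x, 0 < x < 1 ->
    derivable (fun s => gamma s 0 i) x 1}.
  apply: (lipschitz_derivable_ae (L := L)) => x y.
  apply: le_trans (g_lip x y).
  by have := coord_le_enorm (gamma x - gamma y) i; rewrite !mxE.
have {}ae : {ae @lebesgue_measure R, forall x, forall i, 0 < x < 1 ->
    derivable (fun s => gamma s 0 i) x 1}.
  exact: filter_forall.
pose N := ~` [set x : R | forall i, 0 < x < 1 ->
    derivable (fun s => gamma s 0 i) x 1] `|` [set 0; 1].
have : (@lebesgue_measure R).-negligible N.
  apply: negligibleU; first exact: ae.
  have n1 (x : R) : (@lebesgue_measure R).-negligible [set x].
    by exists [set x]; split => //; exact: lebesgue_measure_set1.
  by apply: negligibleU; exact: n1.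
apply: negligibleS => t [t01 tN]; apply: contrapT => /not_orP[/contrapT tder t_neq].
have {}t01 : 0 < t < 1.
  move: t01 => /=; rewrite in_itv /= => /andP[t0 t1].
  rewrite !lt_neqAle t0 t1 !andbT; apply/andP; split; apply/eqP => tE; apply: t_neq.
    by left.
  by right.
have dg : derivable gamma t 1.
  by apply/derivable_mxP => i j; rewrite (ord1 i); exact: tder.
apply: tN; split => //.
have /cvgrPdist_le dcv : h^-1 *: (gamma (h *: 1 + t) - gamma t) @[h --> 0^'] -->
    'D_1 gamma t := dg.
apply/ler_addgt0Pr => e e0.
have d1 : 0 < (d%:R + 1 : R) by rewrite ltr_wpDl.
near (0 : R)^' => h.
have h0 : h != 0 by near: h; exact: nbhs_dnbhs_neq.
have hq : `|'D_1 gamma t - h^-1 *: (gamma (h *: 1 + t) - gamma t)| <= e / (d%:R + 1).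
  by near: h; apply: dcv; rewrite divr_gt0.
set q := h^-1 *: _ in hq.
have qc : c <= enorm q.
  rewrite enormZ normfV ler_pdivlMl ?normr_gt0 // mulrC.
  apply: le_trans (g_low _ _ _ _); last 2 first.
  - have : `|h| < Num.min t (1 - t).
      near: h; apply: dnbhs0_lt; rewrite lt_min; lra.
    rewrite lt_min !ltr_norml /GRing.scale /= mulr1; lra.
  - lra.
  by rewrite /GRing.scale /= mulr1 addrK.
apply: le_trans qc _.
have -> : q = 'D_1 gamma t - ('D_1 gamma t - q) by rewrite subKr.
apply: le_trans (enormD _ _) _; rewrite enormN lerD2l.
apply: le_trans (enorm_le_norm _) _.
apply: le_trans (_ : (d%:R + 1) * (e / (d%:R + 1)) <= _); last first.
  by rewrite mulrC divfK // gt_eqF.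
by apply: ler_pM => //; lra.
Unshelve. all: by end_near. Qed.

End LipschitzCurves.

(** * Chains and the envelope *)

Section Chains.
Variables (R : realType) (d : nat).
Implicit Types x : nat -> pt R d.

Lemma cube_enorm_le (y z : pt R d) : cube y -> cube z -> enorm (y - z) <= d%:R.
Proof.
move=> cy cz; rewrite -[leRHS]mulr1; apply: enorm_le_coord => i; rewrite !mxE.
by have := cy i; have := cz i; rewrite ler_norml; lra.
Qed.

Lemma cube_segment (y z : pt R d) (a : R) : cube y -> cube z -> 0 <= a <= 1 ->
  cube (y + a *: (z - y)).
Proof.
move=> cy cz a01 i; rewrite !mxE; have := cy i; have := cz i.
by set u := y 0 i; set v := z 0 i; nra.
Qed.

(** The cube is convex, so a segment in it can be cut into equal pieces of length at most [t] and
    the local bounds added up. Free steps of chains have length at most [t], so they control the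
    envelope only at this scale. *)
Lemma lip1_of_local (g : pt R d -> R) (t : R) : 0 < t ->
  (forall y z, cube y -> cube z -> enorm (z - y) <= t ->
     g y - enorm (z - y) <= g z) ->
  Lip1 g.
Proof.
move=> t0 gloc.
suff h y z : cube y -> cube z -> g y - enorm (z - y) <= g z.
  move=> y z cy cz; rewrite ler_norml.
  have := h y z cy cz; have := h z y cz cy; rewrite [enorm (z - y)]enorm_distC; lra.
move=> cy cz; set D := z - y.
pose n := (Num.truncn (enorm D / t)).+1.
have n0 : 0 < n%:R :> R by rewrite ltr0n.
have nD : enorm D / n%:R <= t.
  rewrite ler_pdivrMr // mulrC -ler_pdivrMr //; apply/ltW; exact: truncnS_gt.
pose p k := y + (k%:R / n%:R) *: D.
have cp k : (k <= n)%N -> cube (p k).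
  move=> kn; apply: cube_segment => //.
  by rewrite divr_ge0 //= ler_pdivrMr // mul1r ler_nat.
have pS k : p k.+1 - p k = n%:R^-1 *: D.
  rewrite /p opprD addrACA subrr add0r -scalerBl -mulrBl -natr1 addrC addKr mul1r //.
have pSn k : enorm (p k.+1 - p k) = enorm D / n%:R.
  by rewrite pS enormZ ger0_norm ?invr_ge0 ?ler0n // mulrC.
have gp k : (k <= n)%N -> g y - (enorm D / n%:R) * k%:R <= g (p k).
  elim: k => [_|k IH kn]; first by rewrite mulr0 subr0 /p mul0r scale0r addr0.
  have := IH (ltnW kn).
  have := gloc (p k) (p k.+1) (cp _ (ltnW kn)) (cp _ kn).
  rewrite pSn => /(_ nD); rewrite -natr1 mulrDr mulr1; lra.
have := gp n (leqnn n).
by rewrite divfK ?gt_eqF // /p divff ?gt_eqF // scale1r /D [y + _]addrC subrK.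
Qed.

Definition tlen x (i : nat) : R := \sum_(l < i) enorm (x l.+1 - x l).

Lemma tlen0 x : tlen x 0 = 0. Proof. by rewrite /tlen big_ord0. Qed.

Lemma tlenS x i : tlen x i.+1 = tlen x i + enorm (x i.+1 - x i).
Proof. by rewrite /tlen big_ord_recr. Qed.

Lemma tlen_nd x i j : (i <= j)%N -> tlen x i <= tlen x j.
Proof.
elim: j => [|j IH]; first by rewrite leqn0 => /eqP ->.
rewrite leq_eqVlt => /orP[/eqP -> //|/IH h].
by rewrite tlenS; apply: le_trans h _; rewrite lerDl enorm_ge0.
Qed.

Lemma tlen_ge0 x i : 0 <= tlen x i.
Proof. by rewrite -(tlen0 x) tlen_nd. Qed.

Lemma enorm_le_tlen x i j : (i <= j)%N -> enorm (x j - x i) <= tlen x j - tlen x i.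
Proof.
elim: j => [|j IH]; first by rewrite leqn0 => /eqP ->; rewrite !subrr enorm0.
rewrite leq_eqVlt => /orP[/eqP -> //|/IH h]; first by rewrite !subrr enorm0.
by rewrite tlenS; have := enorm_triangle (x j) (x j.+1) (x i); lra.
Qed.

Lemma enorm_le_tlen_dist x i j : enorm (x i - x j) <= `|tlen x i - tlen x j|.
Proof.
wlog ij : i j / (j <= i)%N.
  move=> h; have [/h//|/ltnW /h] := leqP j i.
  by rewrite enorm_distC distrC.
by apply: le_trans (enorm_le_tlen _ ij) (ler_norm _).
Qed.

Variables (E : set (pt R d)) (e : pt R d) (t eta : R).

Definition jlen (b : nat -> bool) (i : nat) : R := \sum_(l < i) t *+ b l.

Lemma jlen0 b : jlen b 0 = 0. Proof. by rewrite /jlen big_ord0. Qed.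

Lemma jlenS b i : jlen b i.+1 = jlen b i + t *+ b i.
Proof. by rewrite /jlen big_ord_recr. Qed.

(* Step [i] is a jump when [b i] holds and a free step otherwise. *)
Definition chain (n : nat) x (b : nat -> bool) : Prop :=
  (forall i, (i <= n)%N -> cube (x i)) /\
  (forall i, (i < n)%N ->
     if b i then E (x i) /\ x i.+1 = x i + t *: e
     else enorm (x i.+1 - x i) <= t).

(* A jump earns [(1 - eta) * t] and a free step costs its length; both kinds of steps
   count in [tlen], hence the factor [2 - eta]. *)
Definition gain x b i : R := (2 - eta) * jlen b i - tlen x i.

Lemma gain0 x b : gain x b 0 = 0.
Proof. by rewrite /gain jlen0 tlen0; ring. Qed.

Hypothesis e1 : enorm e = 1.
Hypothesis t0 : 0 < t.
Hypothesis eta01 : 0 < eta <= 1.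

Lemma chain_stepP n x b i : chain n x b -> (i < n)%N ->
  [/\ b i, E (x i), x i.+1 = x i + t *: e & enorm (x i.+1 - x i) = t] \/
  b i = false /\ enorm (x i.+1 - x i) <= t.
Proof.
move=> [_ /(_ i)] h /h; case: (b i) => [[Ex xS]|xS]; [left|by right].
split => //; rewrite xS addrC addKr enormZ e1 mulr1 gtr0_norm //.
Qed.

Lemma gainS_jump n x b i : chain n x b -> (i < n)%N -> b i ->
  gain x b i.+1 = gain x b i + (1 - eta) * t.
Proof.
move=> cx iN bi; rewrite /gain tlenS jlenS.
have [[_ _ _ ->]|[bif _]] := chain_stepP cx iN; last by rewrite bif in bi.
by rewrite bi mulr1n; ring.
Qed.

Lemma gainS_free x b i : b i = false ->
  gain x b i.+1 = gain x b i - enorm (x i.+1 - x i).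
Proof. by move=> bi; rewrite /gain tlenS jlenS bi mulr0n; ring. Qed.

Lemma chain_prefix n m x b : (m <= n)%N -> chain n x b -> chain m x b.
Proof.
move=> mn [cx sx]; split => i im; [apply: cx | apply: sx]; lia.
Qed.

(* A jump advances by [t] along [e], any other step retreats by at most its length. *)
Lemma chain_dot n x b i j : chain n x b -> (i <= j <= n)%N ->
  2 * (jlen b j - jlen b i) - (tlen x j - tlen x i) <= dot e (x j - x i).
Proof.
move=> cx /andP[]; elim: j => [|j IH].
  by rewrite leqn0 => /eqP -> _; rewrite !subrr dotr0; lra.
rewrite leq_eqVlt => /orP[/eqP -> _|ij jn].
  by rewrite !subrr dotr0; lra.
have {IH} := IH ij (ltnW jn).
have dE : dot e (x j.+1 - x i) = dot e (x j.+1 - x j) + dot e (x j - x i).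
  by rewrite -dotDr subrKA.
rewrite tlenS jlenS dE.
have [[-> _ xS ->]|[-> _]] := chain_stepP cx jn.
  rewrite xS [x j + t *: e]addrC addrK dotZr -enorm_sqr e1 mulr1n; lra.
have := dot_le_enorm e (- (x j.+1 - x j)).
rewrite enormN dotNr e1 mul1r mulr0n; lra.
Qed.

Lemma jlen_le_tlen n x b i j : chain n x b -> (i <= j <= n)%N ->
  0 <= jlen b j - jlen b i <= tlen x j - tlen x i.
Proof.
move=> cx /andP[]; elim: j => [|j IH].
  by rewrite leqn0 => /eqP -> _; rewrite !subrr lexx.
rewrite leq_eqVlt => /orP[/eqP -> _|ij jn]; first by rewrite !subrr lexx.
have {IH} := IH ij (ltnW jn); rewrite tlenS jlenS.
have [[-> _ _ ->]|[-> _]] := chain_stepP cx jn.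
  by have := t0; rewrite mulr1n => *; apply/andP; split; lra.
by have := enorm_ge0 (x j.+1 - x j); rewrite mulr0n => *; apply/andP; split; lra.
Qed.

(** The cap on free steps serves this bound: the vertices leave no gap larger than [t] in arc
    length. *)
Lemma tlen_step n x b i : chain n x b -> (i < n)%N -> tlen x i.+1 <= tlen x i + t.
Proof.
move=> cx iN; rewrite tlenS.
by have [[_ _ _ ->]|[_ h]] := chain_stepP cx iN; rewrite ?lerD2l.
Qed.

(** The gain is at most twice the jump length minus the total length, hence at most the displacement
    along [e], which the diameter of the cube bounds. This makes the supremum over chains finite. *)
Lemma gain_le n x b : chain n x b -> gain x b n <= d%:R.
Proof.
move=> cx; have := chain_dot cx (i := 0) (j := n); rewrite leqnn => /(_ isT).
have := jlen_le_tlen cx (i := 0) (j := n); rewrite leqnn => /(_ isT).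
rewrite tlen0 jlen0 /gain.
have := dot_le_enorm e (x n - x 0); rewrite e1 mul1r.
have [cb _] := cx.
have := cube_enorm_le (cb n (leqnn n)) (cb 0 isT).
have /andP[eta0 eta1] := eta01; nra.
Qed.

(** * The envelope and its nearly optimal chains *)

Variable f : pt R d -> R.
Hypothesis f_lip : Lip1 f.

(** Each chain ending at [y] forces such a lower bound on every 1-Lipschitz majorant of [f] that
    satisfies the jump inequality. *)
Definition reach (y : pt R d) : set R :=
  [set w | exists n x b, [/\ chain n x b, x n = y & w = f (x 0) + gain x b n]].

Definition envelope (y : pt R d) : R := sup (reach y).

Lemma reach_start y : cube y -> reach y (f y).
Proof.
move=> cy; exists 0, (fun=> y), (fun=> false).
by rewrite gain0 addr0; split.
Qed.

Lemma reach_has_sup y : cube y -> has_sup (reach y).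
Proof.
move=> cy; split; first by exists (f y); exact: reach_start.
exists (f y + 2 * d%:R) => _ [n [x [b [cx xn ->]]]].
have := gain_le cx; have [cb _] := cx.
have := f_lip cy (cb 0 isT); have := cube_enorm_le cy (cb 0 isT).
rewrite ler_norml; lra.
Qed.

Lemma reach_le y w : cube y -> reach y w -> w <= envelope y.
Proof.
by move=> cy yw; apply: sup_upper_bound yw; exact: reach_has_sup.
Qed.

Lemma envelope_ge y : cube y -> f y <= envelope y.
Proof. by move=> cy; apply: reach_le => //; exact: reach_start. Qed.

Lemma reach_extend y z (c : bool) w : cube z ->
  (if c then E y /\ z = y + t *: e else enorm (z - y) <= t) ->
  reach y w -> reach z (w + (if c then (1 - eta) * t else - enorm (z - y))).
Proof.
move=> cz step [n [x [b [cx xn ->]]]].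
(* A chain of [n] steps has [n + 1] points but only [n] flags, hence the two different cut-offs. *)
pose x' i := if (i <= n)%N then x i else z.
pose b' i := if (i < n)%N then b i else c.
have xE i : (i <= n)%N -> x' i = x i by rewrite /x' => ->.
have xnS : x' n.+1 = z by rewrite /x' ltnn.
have bE i : (i < n)%N -> b' i = b i by rewrite /b' => ->.
have bn : b' n = c by rewrite /b' ltnn.
have cx' : chain n.+1 x' b'.
  have [cb st] := cx; split => i; rewrite leq_eqVlt => /orP[].
  - by move/eqP => ->; rewrite xnS.
  - by rewrite ltnS => iN; rewrite xE //; exact: cb.
  - by rewrite eqSS => /eqP ->; rewrite bn xnS xE // xn.
  - rewrite ltnS => iN; rewrite bE // !xE //; last exact: ltnW.
    exact: st.
have gE : gain x' b' n = gain x b n.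
  rewrite /gain /jlen /tlen; congr (_ * _ - _); apply: eq_bigr => i _.
    by rewrite bE.
  by rewrite !xE // ltnW.
exists n.+1, x', b'; split => //; rewrite -addrA; congr (_ + _).
case: (boolP c) => cT.
  by rewrite (gainS_jump cx') ?bn // gE.
by rewrite (@gainS_free x' b' n) ?bn ?(negPf cT) // gE xnS xE // xn.
Qed.

Lemma envelope_extend y z c : cube y -> cube z ->
  (if c then E y /\ z = y + t *: e else enorm (z - y) <= t) ->
  envelope y + (if c then (1 - eta) * t else - enorm (z - y)) <= envelope z.
Proof.
move=> cy cz step; rewrite -lerBrDr; apply: ge_sup.
  by exists (f y); exact: reach_start.
by move=> w yw; rewrite lerBrDr; apply: reach_le => //; exact: reach_extend yw.
Qed.

Lemma envelope_lip : Lip1 envelope.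
Proof.
apply: (lip1_of_local t0) => y z cy cz yz.
exact: (envelope_extend (c := false)).
Qed.

Lemma envelope_jump p : cube p -> cube (p + t *: e) -> E p ->
  envelope p + (1 - eta) * t <= envelope (p + t *: e).
Proof. by move=> cp cpt Ep; apply: (envelope_extend (c := true)). Qed.

Lemma envelope_chain n x b i j : chain n x b -> (i <= j <= n)%N ->
  gain x b j - gain x b i <= envelope (x j) - envelope (x i).
Proof.
move=> cx /andP[]; have [cb _] := cx; elim: j => [|j IH].
  by rewrite leqn0 => /eqP -> _; rewrite !subrr.
rewrite leq_eqVlt => /orP[/eqP -> _|ij jn]; first by rewrite !subrr.
have {IH} := IH ij (ltnW jn).
have cj := cb _ (ltnW jn); have cjS := cb _ jn.
have [[bj Ej xS _]|[bj xj]] := chain_stepP cx jn.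
  have := envelope_jump cj; rewrite -xS => /(_ cjS Ej).
  rewrite (gainS_jump cx jn bj); lra.
have := @envelope_extend _ _ false cj cjS xj.
rewrite gainS_free //; lra.
Qed.

(* Along a nearly optimal chain no shortcut can gain more than [t], so the chain
   is a quasi-geodesic. *)
Lemma optimal_chain_tlen n x b i j : chain n x b ->
  envelope (x n) - t <= f (x 0) + gain x b n -> (i <= j <= n)%N ->
  tlen x j - tlen x i <= (5 * enorm (x j - x i) + 3 * t) / eta.
Proof.
move=> cx opt /andP[ij jn]; have [cb _] := cx.
have ht := t0; have /andP[eta0 eta1] := eta01.
have ci := cb _ (leq_trans ij jn); have cj := cb _ jn.
(* Up to [i] the chain collects at most [envelope (x i)], and after [j] it gains at most the rise of
   the envelope. Optimality up to [t] therefore leaves the middle part at least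
   [envelope (x j) - envelope (x i) - t]. *)
have gij : - enorm (x j - x i) - t <= gain x b j - gain x b i.
  have h1 : f (x 0) + gain x b i <= envelope (x i).
    apply: reach_le => //; exists i, x, b; split => //.
    by apply: chain_prefix cx; exact: leq_trans jn.
  have := envelope_chain cx (i := j) (j := n); rewrite jn leqnn => /(_ isT).
  have := envelope_lip ci cj; rewrite enorm_distC ler_norml.
  by lra.
have := chain_dot cx (i := i) (j := j); rewrite ij jn => /(_ isT).
have := jlen_le_tlen cx (i := i) (j := j); rewrite ij jn => /(_ isT).
have := dot_le_enorm e (x j - x i); rewrite e1 mul1r.
have := enorm_ge0 (x j - x i).
rewrite ler_pdivlMr //; move: gij; rewrite /gain.
set D := enorm _; set G := dot _ _.
set J := jlen b j; set J' := jlen b i; set T := tlen x j; set T' := tlen x i.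
move=> gij D0 GD JT dj.
(* The gain bound and the bound along [e] differ by exactly [eta] times the jump length. Multiplying
   the next inequality by [eta <= 1] then yields the constants 5 and 3. *)
have h1 : eta * (J - J') <= 2 * D + t by lra.
have h2 : (T - T') <= 2 * (J - J') + D + t by nra.
nra.
Qed.

(** A jump earns at most [t] while [f] drops by at most [t], and a free step costs at least what [f]
    can lose. Hence exceeding [f] by [eps] takes a jump length of at least [eps / 2]. *)
Lemma chain_jlen n x b : chain n x b ->
  f (x 0) + gain x b n <= f (x n) + 2 * jlen b n.
Proof.
move=> cx; have [cb _] := cx.
suff h i : (i <= n)%N -> f (x 0) + gain x b i <= f (x i) + 2 * jlen b i by exact: h.
elim: i => [_|i IH iN]; first by rewrite gain0 jlen0 mulr0.
have := IH (ltnW iN); have := f_lip (cb _ (ltnW iN)) (cb _ iN).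
rewrite ler_norml enorm_distC.
have ht := t0; have /andP[eta0 eta1] := eta01.
have [[bi _ _ ->]|[bi _]] := chain_stepP cx iN.
  rewrite (gainS_jump cx iN bi) jlenS bi mulr1n; nra.
rewrite gainS_free // jlenS bi mulr0n; lra.
Qed.

Lemma envelope_or_chain (eps : R) : 0 < eps ->
  (forall y, cube y -> envelope y <= f y + eps) \/
  exists n x b, [/\ chain n x b, eps / 2 <= jlen b n &
    forall i j, (i <= j <= n)%N ->
      tlen x j - tlen x i <= (5 * enorm (x j - x i) + 3 * t) / eta].
Proof.
move=> eps0; have [|/existsNP[y /not_implyP[cy ygt]]] :=
  pselect (forall y, cube y -> envelope y <= f y + eps); [by left|right].
have {}ygt : f y + eps < envelope y by rewrite ltNge; apply/negP.
(* One chain must do both: be within [t] of the supremum, to be a quasi-geodesic, and exceed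
   [f y + eps], to contain many jumps. *)
have [_ [n [x [b [cx xn ->]]]]] : exists2 w, reach y w &
    Num.max (envelope y - t) (f y + eps) < w.
  have [] := @sup_adherent _ (reach y)
    (Num.min t (envelope y - f y - eps)) _ (reach_has_sup cy).
    by rewrite lt_min t0 /=; lra.
  move=> w yw; rewrite -/(envelope y) => h; exists w => //.
  move: h; rewrite gt_max /Num.min; case: ifPn => //; rewrite -?leNgt; lra.
rewrite gt_max => /andP[h1 h2].
exists n, x, b; split => //.
  have := chain_jlen cx; rewrite xn; lra.
by move=> i j ij; apply: (optimal_chain_tlen cx _ ij); rewrite xn ltW.
Qed.

End Chains.

(** * Limits of chains *)

Section LimitCurve.
Variables (R : realType) (d : nat).
Local Notation mu := (@lebesgue_measure R).

(** Consecutive half-open intervals are disjoint, so the lengths of the selected ones add up inside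
    [U]. They will be the parameter intervals of the jumps. *)
Lemma measure_ge_intervals (U : set R) (a : nat -> R) (b : nat -> bool) n :
  measurable U -> (forall l, (l < n)%N -> a l <= a l.+1) ->
  (forall l, (l < n)%N -> b l -> `[a l, a l.+1[%classic `<=` U) ->
  ((\sum_(l < n) (a l.+1 - a l) *+ b l)%:E <= mu (U `&` `[a 0%N, a n[%classic))%E.
Proof.
move=> mU; elim: n => [|n IH] a_nd aU; first by rewrite big_ord0 measure_ge0.
have a0n m : (m <= n.+1)%N -> a 0 <= a m.
  elim: m => [//|m IHm mn]; apply: le_trans (IHm (ltnW mn)) (a_nd _ mn).
have /le_trans := IH (fun l ln => a_nd l (ltnW ln)) (fun l ln => aU l (ltnW ln)).
rewrite big_ord_recr /= EFinD => {}IH.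
have -> : U `&` `[a 0, a n.+1[%classic =
    (U `&` `[a 0, a n[%classic) `|` (U `&` `[a n, a n.+1[%classic).
  rewrite -setIUr; congr (_ `&` _); apply/seteqP; split => s /=; rewrite !in_itv /=.
    move=> /andP[s0 sn]; have [sa|sa] := ltP s (a n); first by left; rewrite s0.
    by right; rewrite sn.
  case=> /andP[s0 sn]; apply/andP; split => //.
    exact: lt_le_trans sn (a_nd _ (ltnSn n)).
  exact: le_trans (a0n _ (leqnSn n)) s0.
rewrite measureU; last 3 first.
- by apply: measurableI => //; exact: measurable_itv.
- by apply: measurableI => //; exact: measurable_itv.
- apply/seteqP; split => // s [[_ h1] [_ h2]]; move: h1 h2; rewrite /= !in_itv /=.
  by move=> /andP[_ h1] /andP[h2 _]; move: (lt_le_trans h1 h2); rewrite ltxx.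
apply: leeD; first exact: IH.
case: (boolP (b n)) => bn; last by rewrite mulr0n measure_ge0.
rewrite mulr1n setIC (setIidl (aU n (ltnSn n) bn)).
suff : ((a n.+1 - a n)%:E <= mu `[a n, a n.+1[%classic)%E by [].
rewrite lebesgue_measure_itv /= lte_fin; case: ltP => //.
by move=> h; rewrite lee_fin subr_le0.
Qed.

(* Parametrising by [tlen], up to an error [t], yields a step function; only its limits
   as [t] tends to [0] are continuous. *)
Lemma chain_curve (E : set (pt R d)) (e : pt R d) (t eta eps : R) n x b :
  enorm e = 1 -> 0 < t <= 1 -> 0 < eta <= 1 -> 0 < eps ->
  chain E e t n x b -> eps / 2 <= jlen t b n ->
  (forall i j, (i <= j <= n)%N ->
      tlen x j - tlen x i <= (5 * enorm (x j - x i) + 3 * t) / eta) ->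
  exists g : R -> pt R d,
  [/\ forall s, cube (g s),
      forall s s', enorm (g s - g s') <= (5 * d%:R + 3) / eta * `|s - s'| + t,
      forall s s', 0 <= s <= 1 -> 0 <= s' <= 1 ->
        eps * eta / 10 * `|s - s'| <= enorm (g s - g s') + t &
      forall U : set R, measurable U ->
        (forall s, 0 <= s <= 1 -> ~ U s -> forall p, E p -> t < enorm (g s - p)) ->
        ((eps / 2 / ((5 * d%:R + 3) / eta))%:E <= mu U)%E].
Proof.
move=> e1 /andP[t0 t1] eta01 eps0 cx J_ge quasi.
have /andP[eta0 eta1] := eta01.
have [cb st] := cx.
set L := (5 * d%:R + 3) / eta; set T := tlen x n.
have d0 : 0 <= d%:R :> R := ler0n _ _.
have L0 : 0 < L by rewrite divr_gt0 //; lra.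
(* The quasi-geodesic bound for the whole chain, with the diameter of the cube at most [d] and
   [t <= 1]. *)
have TL : T <= L.
  have := quasi 0 n; rewrite leqnn tlen0 subr0 => /(_ isT) /le_trans; apply.
  rewrite ler_wpM2r ?invr_ge0 ?(ltW eta0) //.
  by have := cube_enorm_le (cb n (leqnn n)) (cb 0 isT); lra.
have JT : jlen t b n <= T.
  have := jlen_le_tlen e1 t0 cx (i := 0) (j := n); rewrite leqnn => /(_ isT).
  by rewrite tlen0 jlen0 !subr0 => /andP[].
have T0 : 0 < T by apply: lt_le_trans (le_trans J_ge JT); lra.
have idxP u : 0 <= u <= T -> exists i, (i <= n)%N && (tlen x i <= u <= tlen x i + t).
  move=> /andP[u0]; rewrite /T.
  have : forall m, (m <= n)%N -> u <= tlen x m ->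
      exists i, (i <= n)%N && (tlen x i <= u <= tlen x i + t).
    elim=> [_|m IH mn um].
      by rewrite tlen0 => u0'; exists 0; rewrite tlen0; apply/andP; split => //; lra.
    have [/(IH (ltnW mn))//|/ltW mu'] := leP u (tlen x m).
    exists m; rewrite ltnW //= mu' /=.
    exact: le_trans um (tlen_step e1 t0 cx mn).
  by move=> h; exact: h.
have uP s : 0 <= clamp s * T <= T.
  have /andP[s0 s1] := clamp_itv s.
  by rewrite mulr_ge0 ?(ltW T0) //= ler_piMl // ltW.
(* A vertex whose arc length lies at most [t] below the target [clamp s * T]. *)
pose idx s := xchoose (idxP _ (uP s)).
have idxE s : [/\ (idx s <= n)%N, tlen x (idx s) <= clamp s * T &
    clamp s * T <= tlen x (idx s) + t].
  by have := xchooseP (idxP _ (uP s)) => /andP[? /andP[? ?]].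
exists (fun s => x (idx s)); split.
- by move=> s; apply: cb; have [] := idxE s.
- move=> s s'; apply: le_trans (enorm_le_tlen_dist _ _ _) _.
  have [_ a1 a2] := idxE s; have [_ b1 b2] := idxE s'.
  have : `|clamp s * T - clamp s' * T| <= L * `|s - s'|.
    rewrite -mulrBl normrM (gtr0_norm T0) mulrC.
    by apply: ler_pM => //; [exact: ltW | exact: clamp_dist].
  by rewrite !ler_norml => /andP[h1 h2]; apply/andP; split; lra.
- move=> s s' s01 s'01.
  have [an a1 a2] := idxE s; have [bn b1 b2] := idxE s'.
  have : `|tlen x (idx s) - tlen x (idx s')| <=
      (5 * enorm (x (idx s) - x (idx s')) + 3 * t) / eta.
    have [ij|/ltnW ij] := leqP (idx s) (idx s').
      rewrite distrC ger0_norm ?subr_ge0 ?tlen_nd // enorm_distC.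
      by apply: quasi; rewrite ij.
    rewrite ger0_norm ?subr_ge0 ?tlen_nd //.
    by apply: quasi; rewrite ij.
  move: a1 a2 b1 b2; rewrite !clamp_id // => a1 a2 b1 b2.
  have : `|s - s'| * T <= `|tlen x (idx s) - tlen x (idx s')| + t.
    rewrite -{1}(gtr0_norm T0) -normrM mulrBl.
    have := ler_norm (tlen x (idx s) - tlen x (idx s')).
    have := ler_norm (- (tlen x (idx s) - tlen x (idx s'))); rewrite normrN.
    by rewrite ler_norml => *; apply/andP; split; lra.
  rewrite ler_pdivlMr // => h2 h1.
  have := normr_ge0 (s - s'); move: h1 h2.
  set D := enorm _; set A := `|s - s'|; set B := `|_ - _| => h1 h2 A0.
  (* Jumps count in the length, so [T >= eps / 2]. Together with the factor [eta / 5] from the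
     quasi-geodesic bound this produces [eps * eta / 10]. *)
  have h3 : A * (eps / 2) <= B + t.
    by apply: le_trans h2; apply: ler_wpM2l => //; exact: le_trans J_ge JT.
  have h4 : A * (eps / 2) * eta <= B * eta + t * eta.
    by rewrite -mulrDl ler_wpM2r // ltW.
  have h5 : t * eta <= t by rewrite ler_piMr // ltW.
  have -> : eps * eta / 10 * A = A * (eps / 2) * eta / 5 by field.
  lra.
- move=> U mU hU.
  (* The jumps occupy parameter intervals of total length [jlen t b n / T], at least [eps / 2]
     divided by [L]. It remains to see that [U] contains them. *)
  pose a l := tlen x l / T.
  apply: le_trans (_ : (mu (U `&` `[a 0%N, a n[%classic) <= _)%E); last first.
    by apply: le_measure => //; rewrite inE //;
      apply: measurableI => //; exact: measurable_itv.
  apply: le_trans (@measure_ge_intervals U a b n mU _ _).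
  + rewrite lee_fin.
    have -> : \sum_(l < n) (a l.+1 - a l) *+ b l = jlen t b n / T.
      rewrite /jlen mulr_suml; apply: eq_bigr => l _.
      rewrite /a -mulrBl tlenS [tlen x l + _]addrC addrK.
      have [[-> _ _ ->]|[-> _]] := chain_stepP e1 t0 cx (ltn_ord l).
        by rewrite !mulr1n.
      by rewrite !mulr0n mul0r.
    apply: ler_pM => //; first lra.
    + by rewrite invr_ge0 ltW.
    + by rewrite lef_pV2.
  + move=> l ln; rewrite ler_wpM2r ?invr_ge0 ?(ltW T0) //.
    exact: tlen_nd.
  + move=> l ln bl s /=; rewrite in_itv /= ler_pdivrMr // ltr_pdivlMr // => /andP[h1 h2].
    apply: contrapT => nUs.
    have s01 : 0 <= s <= 1.
      apply/andP; split.
        by rewrite -(pmulr_lge0 _ T0); apply: le_trans h1; exact: tlen_ge0.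
      rewrite -(ler_pM2r T0) mul1r; apply: le_trans (ltW h2) _; exact: tlen_nd.
    have [[_ El _ _]|[blf _]] := chain_stepP e1 t0 cx ln; last by rewrite blf in bl.
    (* During the jump from [x l], a point of [E], the arc lengths of [x l] and [x (idx s)] differ
       by at most [t]. *)
    have := hU _ s01 nUs _ El; apply/negP; rewrite -leNgt.
    apply: le_trans (enorm_le_tlen_dist _ _ _) _.
    have [_] := idxE s; rewrite clamp_id // => a1 a2.
    have := tlen_step e1 t0 cx ln.
    by rewrite ler_norml => *; apply/andP; split; lra.
Qed.

(** A cluster point of an ultrafilter is a limit. Convergence along one ultrafilter replaces the
    diagonal extraction of subsequences in the style of Arzela and Ascoli. *)
Lemma ultra_compact_cvg (T : topologicalType) (I : Type) (F : set_system I)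
    (K : set T) (u : I -> T) : UltraFilter F -> compact K -> (forall i, K (u i)) ->
  exists2 l, K l & u @ F --> l.
Proof.
move=> UF cK Ku; have PF : ProperFilter F := ultra_proper.
have [l [Kl cl]] := cK (u @ F) _ (filterE _ Ku).
exists l => // A lA; have [//|FnA] := in_ultra_setVsetC (u @^-1` A) UF.
by have [y []] := cl (~` A) A FnA lA.
Qed.

Lemma compact_cube : compact (@cube R d).
Proof.
have -> : @cube R d = [set v : 'rV[R]_d | forall i, `[0, 1]%classic (v ord0 i)].
  by apply/seteqP; split => v h i; have := h i; rewrite /= in_itv.
by apply: (@rV_compact R d (fun=> `[0, 1]%classic)) => i; exact: segment_compact.
Qed.

(** As the errors [t k] vanish, the pointwise limit is bi-Lipschitz on the unit interval and so
    meets [E] in a null set of parameters. An open neighbourhood of that set with measure below [m]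
    contradicts the last hypothesis. *)
Lemma no_curve_sequence (E : set (pt R d)) (g : nat -> R -> pt R d) (t : nat -> R)
    (L c m : R) :
  closed E -> purely_unrectifiable E -> t @ \oo --> (0 : R) ->
  0 < L -> 0 < c -> 0 < m ->
  (forall k s, cube (g k s)) ->
  (forall k s s', enorm (g k s - g k s') <= L * `|s - s'| + t k) ->
  (forall k s s', 0 <= s <= 1 -> 0 <= s' <= 1 ->
     c * `|s - s'| <= enorm (g k s - g k s') + t k) ->
  (forall k (U : set R), measurable U ->
     (forall s, 0 <= s <= 1 -> ~ U s -> forall p, E p -> t k < enorm (g k s - p)) ->
     (m%:E <= mu U)%E) ->
  False.
Proof.
move=> clE puE t_cvg L0 c0 m0 gcube g_lip g_low g_mu.
have [F [UF sF]] := ultraFilterLemma (@eventually_filter).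
have PF : ProperFilter F := ultra_proper.
have [gam gamP] : {gam : R -> pt R d & forall s, g k s @[k --> F] --> gam s}.
  apply: (@choice _ _ (fun s l => g k s @[k --> F] --> l)) => s.
  have [l _ gl] := @ultra_compact_cvg _ _ _ _ (g^~ s) UF compact_cube (fun k => gcube k s).
  by exists l.
have d1 : 0 < (d%:R + 1 : R) by rewrite ltr_wpDl.
have gam_near s (r : R) : 0 < r -> \forall k \near F, enorm (g k s - gam s) <= r.
  move=> r0; have /cvgrPdist_le /(_ (r / (d%:R + 1))) := gamP s.
  rewrite divr_gt0 // => /(_ isT); apply: filterS => k h.
  rewrite enorm_distC; apply: le_trans (enorm_le_norm _) _.
  apply: le_trans (_ : (d%:R + 1) * (r / (d%:R + 1)) <= _); last first.
    by rewrite mulrC divfK // gt_eqF.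
  by apply: ler_pM => //; lra.
have t_near (r : R) : 0 < r -> \forall k \near F, t k <= r.
  move=> r0; apply: sF; have /cvgrPdist_le /(_ r r0) := t_cvg.
  by apply: filterS => k; rewrite sub0r normrN => /ler_normlW.
have gam_lip s s' : enorm (gam s - gam s') <= L * `|s - s'|.
  apply/ler_addgt0Pr => r r0.
  have r3 : 0 < r / 3 by lra.
  near F => k.
  have h1 : enorm (g k s - gam s) <= r / 3 by near: k; exact: gam_near.
  have h2 : enorm (g k s' - gam s') <= r / 3 by near: k; exact: gam_near.
  have h3 : t k <= r / 3 by near: k; exact: t_near.
  have := enorm_triangle (g k s) (gam s) (gam s').
  have := enorm_triangle (g k s') (g k s) (gam s').
  rewrite [enorm (gam s - g k s)]enorm_distC.
  have := g_lip k s s'; lra.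
have gam_low s s' : 0 <= s <= 1 -> 0 <= s' <= 1 ->
    c * `|s - s'| <= enorm (gam s - gam s').
  move=> s01 s'01; apply/ler_addgt0Pr => r r0.
  have r3 : 0 < r / 3 by lra.
  near F => k.
  have h1 : enorm (g k s - gam s) <= r / 3 by near: k; exact: gam_near.
  have h2 : enorm (g k s' - gam s') <= r / 3 by near: k; exact: gam_near.
  have h3 : t k <= r / 3 by near: k; exact: t_near.
  have := enorm_triangle (gam s) (g k s) (g k s').
  have := enorm_triangle (gam s') (gam s) (g k s').
  rewrite [enorm (gam s' - g k s')]enorm_distC.
  have := g_low k s s' s01 s'01; lra.
have [B [mB B0 NB]] := puE _ (bilipschitz_curve c0 gam_lip gam_low).
have [|U [oU BU UB]] := lebesgue_regularity_outer mB _ m0.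
  by rewrite [X in (X < _)%E]B0 ltry.
have mU : measurable U by exact: measurable_realfun.open_measurable.
have Um : (mu U < m%:E)%E.
  apply: le_lt_trans UB.
  have -> : mu U = mu (B `|` (U `\` B)) by rewrite setDUK.
  apply: le_trans (measureU2 _ _ _) _ => //; first exact: measurableD.
  by rewrite [X in (X + _)%E]B0 add0e.
(* Outside [U] the limit curve stays away from [E], hence so do the approximating
   curves, uniformly by compactness: their jumps all take place in [U]. *)
have cK : compact (`[0, 1]%classic `&` ~` U).
  by apply: compact_closedI; [exact: segment_compact | exact: open_closedC].
have /compact_near_coveringP /(_ _ F (fun k s => forall p, E p -> t k < enorm (g k s - p)))
  := cK.
have hcov : forall s, (`[0, 1]%classic `&` ~` U) s -> \forall s' \near s & k \near F,
    forall p, E p -> t k < enorm (g k s' - p).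
  move=> s [s01 nUs].
  have nE : (~` E) (gam s) by move=> Es; apply: nUs; apply: BU; apply: NB.
  have /nbhs_ballP[r /= r0 rE] : nbhs (gam s) (~` E).
    by apply: open_nbhs_nbhs; split => //; exact: closed_openC.
  have far p : E p -> r <= enorm (gam s - p).
    move=> Ep; rewrite leNgt; apply/negP => pr; apply: (rE p) => //.
    rewrite -ball_normE /=; apply: le_lt_trans pr; exact: norm_le_enorm.
  (* Passing from [gam s] to [g k s] and then to [g k s'] loses at most three times [r / 8], so the
     distance to [E] stays above [r / 8 >= t k]. *)
  have r8 : 0 < r / 8 by lra.
  near=> s' k => p Ep.
  have h1 : enorm (g k s - gam s) <= r / 8 by near: k; exact: gam_near.
  have h2 : t k <= r / 8 by near: k; exact: t_near.
  have h3 : L * `|s' - s| <= r / 8.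
    rewrite mulrC -ler_pdivlMr // distrC.
    near: s'; apply: cvgr_dist_le; [exact: cvg_id | by rewrite divr_gt0].
  have := far p Ep; have := g_lip k s' s.
  have := enorm_triangle (g k s) (gam s) p.
  have := enorm_triangle (g k s') (g k s) p.
  rewrite [enorm (gam s - g k s)]enorm_distC [enorm (g k s - g k s')]enorm_distC; lra.
move=> /(_ _ hcov) nearF; near F => k.
have hk : `[0, 1]%classic `&` ~` U `<=` (fun s => forall p, E p -> t k < enorm (g k s - p)).
  by near: k.
have : (m%:E <= mu U)%E.
  by apply: (g_mu k) => // s s01 nUs; apply: hk; split => //=; rewrite in_itv.
by rewrite leNgt Um.
Unshelve. all: by end_near. Qed.

End LimitCurve.

(** * Steep functions are dense *)

Section Typical.
Variables (R : realType) (d : nat).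
Implicit Types (f g h : pt R d -> R) (x v e : pt R d) (E : set (pt R d)).

(** Closed sets exhausting the open cube, with a margin that keeps steps of length at most [m]
    inside the cube. *)
Definition inner_cube (m : R) : set (pt R d) :=
  [set x | forall i, m <= x 0 i <= 1 - m].

Lemma inner_cube_shift m x v (t : R) : inner_cube m x -> enorm v <= 1 ->
  0 <= t <= m -> cube (x + t *: v).
Proof.
move=> xm v1 tm i; rewrite !mxE.
have := le_trans (coord_le_enorm v i) v1; rewrite ler_norml => vi.
have := xm i; move: vi tm; set a := v 0 i; set c := x 0 i.
by move=> *; apply/andP; split; nra.
Qed.

Lemma inner_cube_cube m x : 0 <= m -> inner_cube m x -> cube x.
Proof. by move=> m0 xm i; have := xm i => h; apply/andP; split; lra. Qed.

Lemma closed_inner_cube m : closed (inner_cube m).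
Proof.
have -> : inner_cube m =
    \bigcap_i ((fun x : 'rV[R]_d => x ord0 i) @^-1` `[m, 1 - m]%classic).
  apply/seteqP; split => x h i => [_|]; first by have := h i; rewrite /= in_itv.
  by have := h i I; rewrite /= in_itv.
apply: closed_bigI => i _; apply: preimage_closed.
  by move=> x _; exact: coord_continuous.
exact: itv_closed.
Qed.

Lemma open_cube_inner x : open_cube x ->
  \forall k \near \oo, inner_cube (k.+1%:R^-1) x.
Proof.
move=> ox; apply: filter_forall => i.
have m0 : 0 < Num.min (x 0 i) (1 - x 0 i).
  by have := ox i => /andP[? ?]; rewrite lt_min; apply/andP; split; lra.
have := near_infty_natSinv_lt (PosNum m0); apply: filterS => k /=.
by rewrite lt_min => /andP[h1 h2]; rewrite (ltW h1) /= lerBrDr addrC -lerBrDr ltW.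
Qed.

(** If the envelope failed at each scale of a sequence tending to 0, every scale would yield a curve
    with the same constants, which [no_curve_sequence] excludes. *)
Lemma steep_approximation E e f (m eps eta t1 : R) :
  closed E -> purely_unrectifiable E -> E `<=` inner_cube m -> 0 < m ->
  enorm e = 1 -> Lip1 f -> 0 < eps -> 0 < eta <= 1 -> 0 < t1 ->
  exists t g, [/\ 0 < t < t1, Lip1 g,
    forall y, cube y -> f y <= g y <= f y + eps &
    forall p, E p -> g p + (1 - eta) * t <= g (p + t *: e)].
Proof.
move=> clE puE Em m0 e1 f_lip eps0 eta01 t10; apply: contrapT => nex.
(* The bound 1 is for [chain_curve], [m] keeps jumps in the cube, and [t1] is the prescribed
   scale. *)
pose a := Num.min 1 (Num.min m t1).
have a0 : 0 < a by rewrite !lt_min ltr01 m0 t10.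
have [a1 am at1] : [/\ a <= 1, a <= m & a <= t1].
  by split; rewrite !ge_min lexx ?orbT.
pose t k := a / 2 * (k.+1%:R^-1 : R).
have t0 k : 0 < t k by rewrite mulr_gt0 ?divr_gt0 ?invr_gt0.
have ta k : t k < a.
  apply: le_lt_trans (_ : a / 2 < _); last lra.
  by rewrite ger_pMr ?divr_gt0 // invf_le1 ?ltr0n // ler1n.
have curve k : exists g : R -> pt R d,
  [/\ forall s, cube (g s),
      forall s s', enorm (g s - g s') <= (5 * d%:R + 3) / eta * `|s - s'| + t k,
      forall s s', 0 <= s <= 1 -> 0 <= s' <= 1 ->
        eps * eta / 10 * `|s - s'| <= enorm (g s - g s') + t k &
      forall U : set R, measurable U ->
        (forall s, 0 <= s <= 1 -> ~ U s -> forall p, E p -> t k < enorm (g s - p)) ->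
        ((eps / 2 / ((5 * d%:R + 3) / eta))%:E <= @lebesgue_measure R U)%E].
  have [fle|[n [x [b [cx jn quasi]]]]] :=
      envelope_or_chain E e1 (t0 k) eta01 f_lip eps0.
    exfalso; apply: nex; exists (t k), (envelope E e (t k) eta f); split.
    - by rewrite t0 /=; apply: lt_le_trans (ta k) at1.
    - exact: envelope_lip.
    - by move=> y cy; rewrite fle // andbT; exact: envelope_ge.
    - move=> p Ep; apply: envelope_jump => //.
        by apply: inner_cube_cube (Em _ Ep); exact: ltW.
      apply: inner_cube_shift (Em _ Ep) _ _; first by rewrite e1.
      by rewrite (ltW (t0 k)) /=; apply: le_trans (ltW (ta k)) am.
  apply: (chain_curve e1 _ eta01 eps0 cx jn quasi).
  by rewrite t0 /=; apply: le_trans (ltW (ta k)) a1.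
have /choice[G GP] := curve.
have /andP[eta0 eta1] := eta01.
have L0 : 0 < (5 * d%:R + 3) / eta.
  by have d0 : 0 <= d%:R :> R := ler0n _ _; rewrite divr_gt0 //; lra.
apply: (@no_curve_sequence R d E G t _ (eps * eta / 10)
  (eps / 2 / ((5 * d%:R + 3) / eta)) clE puE _ L0).
- rewrite -(mulr0 (a / 2)); apply: cvgM; [exact: cvg_cst | exact: cvg_harmonic].
- by rewrite divr_gt0 // mulr_gt0.
- by rewrite divr_gt0 // divr_gt0.
- by move=> k; have [h _ _ _] := GP k; exact: h.
- by move=> k; have [_ h _ _] := GP k; exact: h.
- by move=> k; have [_ _ h _] := GP k; exact: h.
- by move=> k; have [_ _ _ h] := GP k; exact: h.
Qed.

(** The exceptional functions: at some point of [E], no quotient at scales below [k.+1%:R^-1] comes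
    within [k.+1%:R^-1] of the extreme slope, which is 1 or -1 according to [b]. A single index
    governs both scale and slope. *)
Definition flat E e (b : bool) (k : nat) : set (pt R d -> R) :=
  [set f | exists2 p, E p & forall t, 0 < t < k.+1%:R^-1 ->
     (-1) ^+ b * (f (p + t *: e) - f p) <= (1 - k.+1%:R^-1) * t].

Lemma Lip1_sign f (b : bool) : Lip1 f -> Lip1 (fun x => (-1) ^+ b * f x).
Proof.
by move=> fL x y cx cy; rewrite -mulrBr normrM normr_sign mul1r; exact: fL.
Qed.

(** The signed function is approximated with half the permitted slope defect. The other half,
    [eta * t], absorbs two errors below [eta * t / 2], so a whole ball around the approximant avoids
    the flat functions; the bound [r / 4] on its radius keeps it inside the given ball. *)
Lemma flat_nowhere_dense E e b k (m : R) :
  closed E -> purely_unrectifiable E -> E `<=` inner_cube m -> 0 < m ->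
  enorm e = 1 -> nowhere_dense_Lip (flat E e b k).
Proof.
move=> clE puE Em m0 e1 f r fL r0.
set s : R := (-1) ^+ b.
have ss : s * s = 1 by rewrite -expr2 sqrr_sign.
have sn z : `|s * z| = `|z| by rewrite normrM normr_sign mul1r.
have k0 : 0 < k.+1%:R^-1 :> R by rewrite invr_gt0 ltr0n.
have k1 : k.+1%:R^-1 <= 1 :> R by rewrite invf_le1 ?ltr0n // ler1n.
set eta := k.+1%:R^-1 / 2 :> R.
have eta01 : 0 < eta <= 1.
  rewrite /eta; move: k0 k1; set kap : R := _^-1 => k0 k1.
  by apply/andP; split; lra.
have r2 : 0 < r / 2 by lra.
have t10 : 0 < Num.min k.+1%:R^-1 m by rewrite lt_min k0 m0.
have [t [g [t01 gL fg gst]]] := steep_approximation clE puE Em m0 e1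
  (Lip1_sign b fL) r2 eta01 t10.
have /andP[t0] := t01; rewrite lt_min => /andP[tk tm]; have /andP[eta0 eta1] := eta01.
have et0 : 0 < eta * t by rewrite mulr_gt0.
have fgd y : cube y -> `|f y - s * g y| <= r / 2.
  move=> cy; rewrite -sn mulrBr mulrA ss mul1r distrC.
  have := fg _ cy; rewrite -/s => /andP[h1 h2].
  by rewrite ler_norml; apply/andP; split; lra.
have nd : Num.min (r / 4) (eta * t / 2) <= r / 4 by rewrite ge_min lexx.
have nd' : Num.min (r / 4) (eta * t / 2) <= eta * t / 2 by rewrite ge_min lexx orbT.
exists (fun x => s * g x), (Num.min (r / 4) (eta * t / 2)); split.
- exact: Lip1_sign.
- by rewrite lt_min; apply/andP; split; lra.
- move=> h [hL [r' r'lt gh]]; split => //; exists (r / 2 + r'); first lra.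
  move=> y cy; have := ler_distD (s * g y) (f y) (h y).
  by have := fgd y cy; have := gh y cy; lra.
- apply/seteqP; split => // h [[hL [r' r'lt gh]] [p Ep /(_ t)]].
  rewrite t0 tk => /(_ isT) hflat.
  have cp : cube p by apply: inner_cube_cube (Em _ Ep); exact: ltW.
  have cpt : cube (p + t *: e).
    by apply: inner_cube_shift (Em _ Ep) _ _; rewrite ?e1 // (ltW t0) ltW.
  have hd y : cube y -> `|g y - s * h y| <= r'.
    by move=> cy; rewrite -sn mulrBr mulrA ss mul1r; exact: gh.
  have := hd _ cp; have := hd _ cpt; have := gst _ Ep; move: hflat.
  rewrite -/s mulrBr !ler_norml.
  have -> : k.+1%:R^-1 = 2 * eta by rewrite /eta mulrCA divff ?mulr1 // pnatr_eq0.
  move=> a1 a2 /andP[a3 a4] /andP[a5 a6]; suff : False by [].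
  move: nd' r'lt; set w := Num.min _ _ => nd' r'lt; lra.
Qed.

End Typical.

(** * Derived sets of typical functions *)

Section Derived.
Variables (R : realType) (d : nat).
Implicit Types (f g h : pt R d -> R) (x v e : pt R d) (E : set (pt R d)).

(* Unit vector, except that [rat_dir 0 = 0]. *)
Definition rat_dir (q : 'rV[rat]_d) : pt R d :=
  let u : pt R d := map_mx ratr q in (enorm u)^-1 *: u.

Lemma rat_dir_dense v (eta : R) : enorm v = 1 -> 0 < eta ->
  exists q, enorm (rat_dir q) = 1 /\ enorm (rat_dir q - v) <= eta.
Proof.
move=> v1 eta0.
have d1 : 0 < (d%:R + 1 : R) by rewrite ltr_wpDl.
(* Half of [eta] pays for rational approximation and half for normalisation; the bound [1 / 2] keeps
   [u] nonzero. *)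
pose a := Num.min (eta / 2) (1 / 2).
have [ae a2] : a <= eta / 2 /\ a <= 1 / 2 by split; rewrite ge_min lexx ?orbT.
have a0 : 0 < a by rewrite lt_min; apply/andP; split; lra.
have /choice[q qP] (i : 'I_d) : exists r : rat, `|ratr r - v 0 i| <= a / (d%:R + 1).
  have b0 : 0 < a / (d%:R + 1) by rewrite divr_gt0.
  have [r] := @rat_in_itvoo R (v 0 i - a / (d%:R + 1)) (v 0 i + a / (d%:R + 1)) ltac:(lra).
  by rewrite in_itv /= => /andP[h1 h2]; exists r; rewrite ler_norml; apply/andP; split; lra.
pose u : pt R d := map_mx ratr (\row_i q i).
have uv : enorm (u - v) <= a.
  apply: le_trans (@enorm_le_coord _ _ _ (a / (d%:R + 1)) _) _.
    by move=> i; rewrite !mxE; exact: qP.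
  apply: le_trans (_ : (d%:R + 1) * (a / (d%:R + 1)) <= _); last first.
    by rewrite mulrC divfK // gt_eqF.
  by apply: ler_pM => //; [rewrite divr_ge0 ?ltW | lra].
have u_ge : 1 - a <= enorm u.
  by have := enormD (v - u) u; rewrite subrK v1 enorm_distC; lra.
have u_le : enorm u <= 1 + a.
  by have := enormD (u - v) v; rewrite subrK v1; lra.
have u0 : 0 < enorm u by lra.
exists (\row_i q i); rewrite /rat_dir -/u; split.
  by rewrite enormZ gtr0_norm ?invr_gt0 // mulVf // gt_eqF.
apply: le_trans (enorm_triangle u _ _) _.
have -> : (enorm u)^-1 *: u - u = ((enorm u)^-1 * (1 - enorm u)) *: u.
  by rewrite mulrBr mulr1 mulVf ?gt_eqF // scalerBl scale1r.
rewrite enormZ normrM (gtr0_norm (x := _^-1)) ?invr_gt0 // mulrAC mulVf ?gt_eqF // mul1r.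
have : `|1 - enorm u| <= a by rewrite ler_norml; apply/andP; split; lra.
lra.
Qed.

Section OnePoint.
Variables (f : pt R d -> R) (x v : pt R d) (rho : R).
Hypothesis f_lip : Lip1 f.
Hypothesis v1 : enorm v = 1.
Hypothesis rho0 : 0 < rho.
Hypothesis x_cube : forall t, 0 <= t <= rho -> cube (x + t *: v).
Hypothesis steep : forall (b : bool) (eta : R), 0 < eta -> exists2 t, 0 < t < eta &
  (1 - eta) * t <= (-1) ^+ b * (f (x + t *: v) - f x).

Lemma ray_lip s t : 0 <= s <= rho -> 0 <= t <= rho ->
  `|f (x + s *: v) - f (x + t *: v)| <= `|s - t|.
Proof.
move=> sr tr; apply: le_trans (f_lip (x_cube sr) (x_cube tr)) _.
by rewrite opprD addrACA subrr add0r -scalerBl enormZ v1 mulr1.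
Qed.

(** Subtract the line of slope [l]. A steep rise at [t1] makes the difference at least [- eta * t1],
    and a steep fall at [t2] makes it at most [eta * t2]. Either one of these points already serves,
    or the signs are opposite and the difference vanishes in between. *)
Lemma difference_quotient_ivt (l eta : R) : -1 <= l <= 1 -> 0 < eta ->
  exists2 t, 0 < t < eta & `|f (x + t *: v) - f x - l * t| <= eta * t.
Proof.
move=> /andP[lN1 l1] eta0.
pose a := Num.min eta rho.
have [ae ar] : a <= eta /\ a <= rho by split; rewrite ge_min lexx ?orbT.
have a0 : 0 < a by rewrite lt_min eta0.
pose psi t := f (x + t *: v) - f x - l * t.
have psi_lip s t : 0 <= s <= rho -> 0 <= t <= rho -> `|psi s - psi t| <= 2 * `|s - t|.
  move=> sr tr; have := ray_lip sr tr.
  have -> : psi s - psi t = (f (x + s *: v) - f (x + t *: v)) - l * (s - t).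
    by rewrite /psi; ring.
  move=> h; apply: le_trans (ler_normB _ _) _; rewrite normrM.
  have : `|l| <= 1 by rewrite ler_norml lN1.
  by have := normr_ge0 (s - t); nra.
have [t1 /andP[t10 t1a]] := steep false a0; rewrite expr0 mul1r => h1.
have [t2 /andP[t20 t2a]] := steep true a0; rewrite expr1 mulN1r => h2.
have [p1|p1] := leP (psi t1) 0.
  exists t1; first by rewrite t10 /=; lra.
  rewrite -/(psi t1) ler0_norm //; move: p1; rewrite /psi => p1; nra.
have [p2|p2] := leP 0 (psi t2).
  exists t2; first by rewrite t20 /=; lra.
  rewrite -/(psi t2) ger0_norm //; move: p2; rewrite /psi => p2; nra.
have psi_cont t : 0 < t < rho -> {for t, continuous psi}.
  move=> /andP[t0 tr]; apply/cvgrPdist_le => r r0; near=> s.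
  apply: le_trans (psi_lip _ _ _ _) _.
  - by rewrite !ltW.
  - apply/andP; split; near: s.
      by apply: filterS (lt_nbhsr t0) => ? /ltW.
    by apply: filterS (lt_nbhsl tr) => ? /ltW.
  - rewrite mulrC -ler_pdivlMr //.
    near: s; apply: cvgr_dist_le; [exact: cvg_id | by rewrite divr_gt0].
have ivt u w : 0 < u < a -> 0 < w < a -> u <= w ->
    Num.min (psi u) (psi w) <= 0 <= Num.max (psi u) (psi w) ->
    exists2 t, 0 < t < eta & psi t = 0.
  move=> /andP[u0 ua] /andP[w0 wa] uw h.
  have [t tuw pt0] : exists2 t, t \in `[u, w] & psi t = 0.
    apply: IVT => //; apply: continuous_in_subspaceT => t.
    rewrite inE /= in_itv /= => /andP[ut tw]; apply: psi_cont.
    by apply/andP; split; lra.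
  exists t => //; move: tuw; rewrite in_itv /= => /andP[ut tw].
  by apply/andP; split; lra.
have [t te pt0] : exists2 t, 0 < t < eta & psi t = 0.
  have [t12|/ltW t12] := leP t1 t2.
    apply: (ivt t1 t2); rewrite ?t10 ?t20 //.
    by rewrite ge_min le_max (ltW p2) (ltW p1) orbT.
  apply: (ivt t2 t1); rewrite ?t10 ?t20 //.
  by rewrite ge_min le_max (ltW p2) (ltW p1) orbT.
exists t => //; rewrite -/(psi t) pt0 normr0.
by have /andP[t0 _] := te; rewrite mulr_ge0 // ltW.
Unshelve. all: by end_near. Qed.

Lemma derived_set_full : derived_set f x v = `[-1, 1]%classic.
Proof.
apply/seteqP; split => l /=.
  move=> [t [t0 _ t_cvg q_cvg]].
  have clI : closed `[(-1 : R), 1]%classic by exact: itv_closed.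
  apply: (closed_cvg _ clI _ _ q_cvg).
  near=> n; have tn : 0 <= t n <= rho.
    rewrite ltW //=; near: n.
    have /cvgrPdist_le /(_ _ rho0) := t_cvg; apply: filterS => n.
    by rewrite sub0r normrN; exact: ler_normlW.
  have := @ray_lip (t n) 0 tn; rewrite lexx (ltW rho0) => /(_ isT).
  rewrite scale0r addr0 subr0 (gtr0_norm (t0 n)) => h.
  rewrite /= in_itv /= -ler_norml normrM normfV (gtr0_norm (t0 n)).
  by rewrite ler_pdivrMr // mul1r.
rewrite in_itv /= => l1.
have /choice[tau tauP] : forall eta : R, exists t, 0 < eta ->
    0 < t < eta /\ `|f (x + t *: v) - f x - l * t| <= eta * t.
  move=> eta; have [eta0|eta0] := ltP 0 eta; last by exists 0.
  by have [t h1 h2] := difference_quotient_ivt l1 eta0; exists t.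
(* The first argument of the minimum forces strict decrease; the second ensures [t n < n.+1%:R^-1],
   hence convergence to 0. *)
pose t := fix t n := if n is m.+1 then tau (Num.min (t m) m.+2%:R^-1) else tau 1.
have tS n : t n.+1 = tau (Num.min (t n) n.+2%:R^-1) by [].
have t0 n : 0 < t n.
  elim: n => [|n IH]; first by have [/andP[]] := tauP 1 ltr01.
  by rewrite tS; have [|/andP[]] := tauP (Num.min (t n) n.+2%:R^-1);
    first rewrite lt_min IH invr_gt0 ltr0n.
have tP n : exists2 eta : R, eta <= n.+1%:R^-1 &
    t n < eta /\ `|f (x + t n *: v) - f x - l * t n| <= eta * t n.
  case: n => [|n].
    by exists 1; [rewrite invr1 | have [/andP[]] := tauP 1 ltr01].
  exists (Num.min (t n) n.+2%:R^-1); first by rewrite ge_min lexx orbT.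
  by rewrite tS; have [|/andP[]] := tauP (Num.min (t n) n.+2%:R^-1);
    first rewrite lt_min t0 invr_gt0 ltr0n.
exists t; split => //.
- move=> n; rewrite tS.
  have [|/andP[_ + _]] := tauP (Num.min (t n) n.+2%:R^-1).
    by rewrite lt_min t0 invr_gt0 ltr0n.
  by rewrite lt_min => /andP[].
- apply/cvgrPdist_le => r r0.
  have := near_infty_natSinv_lt (PosNum r0); apply: filterS => n /= nr.
  have [eta en [te _]] := tP n.
  by rewrite sub0r normrN gtr0_norm // ltW // (lt_le_trans te) // (le_trans en) // ltW.
- apply/cvgrPdist_le => r r0.
  have := near_infty_natSinv_lt (PosNum r0); apply: filterS => n /= nr.
  have [eta en [_ he]] := tP n.
  apply: le_trans (_ : eta <= _); last by rewrite (le_trans en) // ltW.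
  have -> : l - (f (x + t n *: v) - f x) / t n =
      - ((f (x + t n *: v) - f x - l * t n) / t n).
    by field; rewrite gt_eqF.
  by rewrite normrN normrM normfV (gtr0_norm (t0 n)) ler_pdivrMr.
Unshelve. all: by end_near. Qed.

End OnePoint.

(** A directional derivative would be the limit along every sequence, hence equal to both 1 and
    -1. *)
Lemma derived_set_full_no_deriv f x v :
  derived_set f x v = `[-1, 1]%classic -> ~ has_dir_deriv f x v.
Proof.
move=> fxv [l /cvg_at_rightP q_cvg].
have dl l' : `[-1, 1]%classic l' -> l = l'.
  rewrite -fxv => -[t [t0 _ t_cvg q_l']].
  by apply: cvg_unique (q_cvg t (conj t0 t_cvg)) q_l'.
have e1 : l = 1 by apply: dl; rewrite /= in_itv /= lexx andbT; lra.
have e2 : l = -1 by apply: dl; rewrite /= in_itv /= lexx /=; lra.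
have e12 : (1 : R) = -1 := etrans (esym e1) e2; clear -e12; lra.
Qed.

End Derived.

(** * Conclusion by countably many nowhere dense sets *)

Theorem theorem2p7 (R : realType) (d : nat) (hd : (1 <= d)%N)
    (A : set (pt R d)) (hA : A `<=` @open_cube R d)
    (hcov : exists P : set (pt R d),
       [/\ Fsigma P, purely_unrectifiable P & A `<=` P]) :
  typical (fun f => forall x v, A x -> sphere v -> ~ has_dir_deriv f x v) /\
  typical (fun f => forall x v, A x -> sphere v ->
                      derived_set f x v = `[-1, 1]%classic).
Proof.
have [P [[F [clF PE]] puP AP]] := hcov.
(* These pieces are closed, inherit pure unrectifiability from [P], have a positive margin and
   together cover [A]. *)
pose E n j : set (pt R d) := F n `&` inner_cube (j.+1%:R^-1).
pose idx : countType := (nat * nat * nat * bool * 'rV[rat]_d)%type.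
pose N (i : nat) : set (pt R d -> R) :=
  if (unpickle i : option idx) is Some (n, j, k, b, q) then
    [set f | enorm (rat_dir R q) = 1 /\ flat (E n j) (rat_dir R q) b k f]
  else set0.
have nd0 : nowhere_dense_Lip (@set0 (pt R d -> R)).
  by move=> f r fL r0; exists f, r; rewrite setI0; split.
have ndN i : nowhere_dense_Lip (N i).
  rewrite /N; case: unpickle => [[[[[n j] k] b] q]|//].
  have [q1|q1] := pselect (enorm (rat_dir R q) = 1); last first.
    suff -> : [set f | enorm (rat_dir R q) = 1 /\ flat (E n j) (rat_dir R q) b k f] = set0.
      exact: nd0.
    by apply/seteqP; split => // f [].
  have j0 : 0 < j.+1%:R^-1 :> R by rewrite invr_gt0 ltr0n.
  have puE : purely_unrectifiable (E n j).
    move=> g /puP; apply: negligibleS => s [s01 [Fs _]]; split => //.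
    by rewrite /= PE; exists n.
  have clE : closed (E n j) by apply: closedI => //; exact: closed_inner_cube.
  have := flat_nowhere_dense b k clE puE (@subIsetr _ _ _) j0 q1.
  suff -> : [set f | enorm (rat_dir R q) = 1 /\ flat (E n j) (rat_dir R q) b k f] =
      flat (E n j) (rat_dir R q) b k by [].
  by apply/seteqP; split => f; [case|split].
have full f : Lip1 f -> ~ (\bigcup_i N i) f -> forall x v, A x -> sphere v ->
    derived_set f x v = `[-1, 1]%classic.
  move=> fL fN x v Ax v1.
  have [n _ Fx] : (\bigcup_n F n) x by rewrite -PE; exact: AP.
  have xin := open_cube_inner (hA x Ax).
  have [j xj] : exists j, inner_cube (j.+1%:R^-1) x.
    by near \oo => j; exists j; near: j.
  have j0 : 0 < j.+1%:R^-1 :> R by rewrite invr_gt0 ltr0n.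
  apply: (@derived_set_full R d f x v j.+1%:R^-1) => //.
    by move=> t; apply: inner_cube_shift xj _; rewrite v1.
  move=> b eta eta0.
  have eta2 : 0 < eta / 2 by lra.
  have [q [q1 qv]] := rat_dir_dense v1 eta2.
  have m0 : 0 < Num.min (eta / 2) j.+1%:R^-1 by rewrite lt_min eta2.
  (* Half of [eta] covers the slope defect, the other half the change from the rational direction to
     [v]; the second bound keeps the steps in the cube. *)
  have [k] : exists k : nat, k.+1%:R^-1 < Num.min (eta / 2) (j.+1%:R^-1 : R).
    near \oo => k; exists k; near: k; exact: (near_infty_natSinv_lt (PosNum m0)).
  rewrite lt_min => /andP[ke kj].
  have nflat : ~ flat (E n j) (rat_dir R q) b k f.
    move=> fflat; apply: fN; exists (pickle ((n, j, k, b, q) : idx)) => //.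
    by rewrite /N pickleK.
  apply: contrapT => nex; apply: nflat; exists x => // t /andP[t0 tk].
  rewrite leNgt; apply/negP => ht; apply: nex; exists t.
    by rewrite t0 /=; apply: lt_trans tk _; apply: lt_trans ke _; lra.
  have tj : 0 <= t <= j.+1%:R^-1 by rewrite ltW //= ltW // (lt_trans tk).
  have c1 : cube (x + t *: rat_dir R q) by apply: inner_cube_shift xj _ tj; rewrite q1.
  have c2 : cube (x + t *: v) by apply: inner_cube_shift xj _ tj; rewrite v1.
  have hd2 : (-1) ^+ b * f (x + t *: rat_dir R q) - (-1) ^+ b * f (x + t *: v) <=
      t * enorm (rat_dir R q - v).
    apply: le_trans (ler_norm _) _; rewrite -mulrBr normrM normr_sign mul1r.
    apply: le_trans (fL _ _ c1 c2) _.
    by rewrite opprD addrACA subrr add0r -scalerBr enormZ (gtr0_norm t0).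
  have hd3 : t * enorm (rat_dir R q - v) <= t * (eta / 2) by rewrite ler_wpM2l // ltW.
  have hk : k.+1%:R^-1 * t <= eta / 2 * t by rewrite ler_wpM2r // ltW.
  move: ht hd2 hd3 hk; rewrite !mulrBr !mulrBl !mul1r.
  set sg : R := (-1) ^+ b; set kap : R := k.+1%:R^-1 * t.
  set D := enorm _; set a1 := sg * _; set a2 := sg * _; set a3 := sg * _.
  lra.
have typ (Q : (pt R d -> R) -> Prop) :
    (forall f, Lip1 f -> ~ (\bigcup_i N i) f -> Q f) -> typical Q.
  move=> QN; exists N; split => // f [fL nQ].
  by apply: contrapT => fN; apply: nQ; exact: QN.
split; apply: typ => f fL fN x v Ax Sv; last exact: full.
by apply: derived_set_full_no_deriv; exact: full.
Unshelve. all: by end_near. Qed.
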